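(* For the path $P_n$ on $n\ge 1$ vertices, $$SC(P_n)=\begin{cases}1 & \text{if } n=1,\\ 2 & \text{if } n=2,\\ 0 & \text{if } n=3,\\ 4 & \text{if } 4\le n\le 7,\\ 5 & \text{if } 8\le n\le 11,\\ 6 & \text{if } n\ge 12.\end{cases}$$
   Context: Graphs are finite, simple and undirected, with nonempty vertex set $V(G)$; the order is $n=|V(G)|$. A set $D\subseteq V(G)$ is a strong dominating set of $G$ if for every $x\in V(G)\setminus D$ there is $y\in D$ with $xy\in E(G)$ and $\deg(x)\le\deg(y)$. Two disjoint sets $V_1,V_2\subseteq V(G)$ form a strong coalition if neither is a strong dominating set but $V_1\cup V_2$ is a strong dominating set. A strong coalition partition of $G$ is a partition $\Omega=\{V_1,\dots,V_k\}$ of $V(G)$ into nonempty sets such that each $V_i$ either is a strong dominating set consisting of a single vertex of degree $n-1$, or is not a strong dominating set but forms a strong coalition with another set $V_j\in\Omega$ that is not a strong dominating set. The strong coalition number $SC(G)$ is the maximum cardinality of a strong coalition partition of $G$, with $SC(G)=0$ if $G$ has no strong coalition partition. *)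

(* Defs.v *)
From mathcomp Require Import all_boot.

Set Implicit Arguments.
Unset Strict Implicit.
Unset Printing Implicit Defensive.

(* A finite simple graph is a symmetric irreflexive relation [e] on a         *)
(* finType [T]; the order of the graph is #|T|.                               *)

Section StrongCoalition.

Variables (T : finType) (e : rel T).

Implicit Types (D A B : {set T}) (P : {set {set T}}).

Definition deg (x : T) : nat := #|[set y | e x y]|.

Definition strong_dominating D : bool :=
  [forall (x | x \notin D), exists y in D, e x y && (deg x <= deg y)].

Definition strong_coalition A B : bool :=
  [&& [disjoint A & B], ~~ strong_dominating A, ~~ strong_dominating B
    & strong_dominating (A :|: B)].

Definition dominating_singleton A : bool :=
  strong_dominating A && [exists x, (A == [set x]) && (deg x == #|T|.-1)].

(* [partition P [set: T]] requires the blocks of P to be nonempty.            *)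
Definition strong_coalition_partition P : bool :=
  partition P [set: T] &&
  [forall A in P,
    dominating_singleton A
    || ~~ strong_dominating A && [exists B in P, strong_coalition A B]].

(* The empty maximum is 0, as required when no such partition exists.         *)
Definition SC : nat := \max_(P | strong_coalition_partition P) #|P|.

End StrongCoalition.

Definition path_graph (n : nat) : rel 'I_n :=
  fun i j => (i.+1 == j :> nat) || (j.+1 == i :> nat).

Lemma path_graph_sym n : symmetric (@path_graph n).
Proof. by move=> i j; rewrite /path_graph orbC. Qed.

Lemma path_graph_irrefl n : irreflexive (@path_graph n).
Proof. by move=> i; rewrite /path_graph orbb eqn_leq ltnn. Qed.

(* Main.v *)
Require Import Defs.
From mathcomp Require Import all_boot zify.

Set Implicit Arguments.
Unset Strict Implicit.
Unset Printing Implicit Defensive.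

(** A set is strong dominating iff it meets, for every vertex x, the set
    [hood x] made of x and the neighbours of x of degree at least [deg x]. On a
    path with n >= 4 vertices 0, ..., n-1, [hood x] is {x-1, x, x+1} for
    2 <= x <= n-3, and {0,1}, {1,2}, {n-3,n-2}, {n-2,n-1} for the four remaining
    vertices; moreover no vertex has degree n-1. Given a strong coalition
    partition, call trace of x the set of classes that meet [hood x]. Then
    - every trace meets every coalition (it is a vertex cover of the coalition
      graph, in which no class is isolated), and
    - every class misses some trace, so its coalition partners all lie in a set
      of at most three classes.

    Suppose that there are at least five classes. A trace cannot be a single
    class A: all other classes would be partners of A, hence lie in a trace
    missed by A. So the traces of 0, 1, n-2 and n-1 are pairs. A finer analysis
    of vertex covers with two elements shows that at most three classes belong
    to such pairs ([card_pair_traces]). The other classes, at least two, live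
    on the positions 3, ..., n-4, whence n >= 8.

    Let {A, B} be the trace of 0. If A misses the trace X and B misses the trace
    Y, then every class lies in {A, B} or in X \ {B} or in Y \ {A}. If B is not in
    X, then B misses X and one may take Y = X, which leaves at most five classes;
    similarly if A is not in Y; otherwise there are at most six. If there are
    six, then X = {B} + CS and Y = {A} + DS with CS and DS disjoint pairs, and
    every trace contains A or all of CS, and B or all of DS ([two_class_trace]). Reading the classes along the path as a
    word, it begins with A B A and ends with an alternation of A and B, while
    the windows X and Y must fit in between, properly separated: this forces
    n >= 12 ([word_length]).

    The lower bounds for n >= 4 come from explicit words: a prefix 0123, 01234 or
    010450123, followed by an alternation of 0 and 1. For n <= 2 all singletons
    are dominating singletons. For n = 3 the sets that contain the middle
    vertex are exactly the strong dominating ones, so no coalition exists, and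
    an end vertex lies in no legal class. *)

(** * Vertex covers of the coalition graph *)

(** The combinatorial core, free of graphs: [P] is the set of classes, [co] the
    coalition relation, and [tr x] the set of classes that meet the closed
    strong neighbourhood of x. *)
Section Traces.

Variables (T K : finType) (P : {set K}) (co : rel K) (tr : T -> {set K}).

Hypothesis co_sym : symmetric co.
Hypothesis trP : forall x, tr x \subset P.
Hypothesis partner : forall A, A \in P -> exists2 B, B \in P & co A B.
Hypothesis tr_cover : forall A B x,
  A \in P -> B \in P -> co A B -> (A \in tr x) || (B \in tr x).
Hypothesis tr_miss : forall A, A \in P -> exists x, A \notin tr x.
Hypothesis card_tr : forall x, #|tr x| <= 3.

(** A class outside two traces has its partner in both of them. *)
Lemma partner_in_traces x y A :
    A \in P -> A \notin tr x -> A \notin tr y ->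
  exists B, [/\ B \in tr x, B \in tr y & co A B].
Proof.
move=> PA nAx nAy; have [B PB AB] := partner PA; exists B.
have := tr_cover x PA PB AB; have := tr_cover y PA PB AB.
by rewrite (negPf nAx) (negPf nAy).
Qed.

Lemma in_missed_trace x A B :
  A \in P -> B \in P -> co A B -> A \notin tr x -> B \in tr x.
Proof.
by move=> PA PB AB nAx; have := tr_cover x PA PB AB; rewrite (negPf nAx).
Qed.

(** If the coalition graph is a star centred at A, then a trace missed by A
    contains all the other classes. *)
Lemma card_star A : A \in P ->
  (forall B, B \in P -> B != A -> co B A) -> #|P| <= 4.
Proof.
move=> PA star; have [x nAx] := tr_miss PA.
have sub : P \subset A |: tr x.
  apply/subsetP=> B PB; rewrite !inE; have [//|BA /=] := eqVneq B A.
  by apply: (in_missed_trace PA) => //; rewrite co_sym; apply: star.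
apply: leq_trans (subset_leq_card sub) _; rewrite cardsU1.
by have := card_tr x; case: (_ \notin _); lia.
Qed.

Lemma card_trace_gt1 z : 4 < #|P| -> 1 < #|tr z|.
Proof.
move=> P5; rewrite ltnNge; apply/negP=> /card_le1_eqP le1.
have /card_gt0P[W PW] : 0 < #|P| by lia.
have [A PA trA] : exists2 A, A \in P & tr z \subset [set A].
  have [Wz|nWz] := boolP (W \in tr z).
    by exists W => //; apply/subsetP=> B Bz; rewrite inE (le1 B W).
  have [A [Az _ _]] := partner_in_traces PW nWz nWz.
  exists A; first exact: (subsetP (trP z)).
  by apply/subsetP=> B Bz; rewrite inE (le1 B A).
suff : #|P| <= 4 by lia.
apply: (card_star PA) => B PB BA.
have nBz : B \notin tr z.
  by apply: contra BA => Bz; have := subsetP trA _ Bz; rewrite inE.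
have [C [Cz _ BC]] := partner_in_traces PB nBz nBz.
by have := subsetP trA _ Cz; rewrite inE => /eqP <-.
Qed.

Lemma ex_notin (S : {set K}) : #|S| < #|P| -> exists2 W, W \in P & W \notin S.
Proof.
move=> ltSP; apply/subsetPn; apply/negP=> /subset_leq_card; lia.
Qed.

(** Two pairs among the traces share a class A, because some fifth class lies
    outside both. If {A, B} and {A, Z} are two distinct pairs, every pair is
    contained in {A, B, Z}: one avoiding A would contain all partners of A, and
    a pair {A, Y} with a new class Y would make the coalition graph a star
    centred at A. *)
Lemma card_pair_traces : 4 < #|P| ->
  #|\bigcup_(x | #|tr x| <= 2) tr x| <= 3.
Proof.
move=> P5.
have pair x : #|tr x| <= 2 -> #|tr x| = 2.
  by move=> le2; apply/eqP; rewrite eqn_leq le2 card_trace_gt1.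
have pairE x A : #|tr x| <= 2 -> A \in tr x ->
    exists2 B, A != B & tr x = [set A; B].
  move=> /pair/eqP/cards2P[B [C [BC ->]]]; rewrite !inE.
  case/orP=> /eqP->; first by exists C.
  by exists B; [rewrite eq_sym | rewrite setUC].
have [x0 le0|none] := pickP (fun x => #|tr x| <= 2); last first.
  by rewrite big_pred0 ?cards0.
have [x1 /andP[le1 ne01]|all0] :=
    pickP (fun x => (#|tr x| <= 2) && (tr x != tr x0)); last first.
  apply: leq_trans (_ : #|tr x0| <= 3) => //; apply: subset_leq_card.
  apply/bigcupsP=> x lex; have := all0 x; rewrite lex /= => /negbFE/eqP->.
  exact: subxx.
have [|W PW] := @ex_notin (tr x0 :|: tr x1).
  by rewrite cardsU (pair _ le0) (pair _ le1); lia.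
rewrite inE negb_or => /andP[nW0 nW1].
have [A [A0 A1 _]] := partner_in_traces PW nW0 nW1.
have PA : A \in P by apply: (subsetP (trP x0)).
have [B AB tr0] := pairE _ _ le0 A0.
have [Z AZ tr1] := pairE _ _ le1 A1.
have BZ : B != Z by apply: contraNneq ne01 => BZ; rewrite tr0 tr1 BZ.
have [PB PZ] : B \in P /\ Z \in P.
  by split; [apply: (subsetP (trP x0)); rewrite tr0 !inE eqxx orbT
           | apply: (subsetP (trP x1)); rewrite tr1 !inE eqxx orbT].
(* every class outside the two pairs is a partner of their common element A *)
have coA V : V \in P -> V \notin [set A; B; Z] -> co A V.
  rewrite !inE !negb_or => PV /andP[/andP[VA VB] VZ].
  have [||C [C0 C1 VC]] := @partner_in_traces x0 x1 V PV.
  - by rewrite tr0 !inE negb_or VA.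
  - by rewrite tr1 !inE negb_or VA.
  move: C0 C1 VC; rewrite tr0 tr1 !inE.
  case/orP=> /eqP->; first by rewrite co_sym.
  by rewrite eq_sym (negPf AB) (negPf BZ).
have le3 : #|[set A; B; Z]| <= 3.
  by rewrite setUC cardsU1 cards2; case: (_ \notin _); case: (_ != _).
suff sub : \bigcup_(x | #|tr x| <= 2) tr x \subset [set A; B; Z].
  exact: leq_trans (subset_leq_card sub) le3.
apply/bigcupsP=> x lex.
have Ax : A \in tr x.
  apply/negPn/negP=> nAx.
  (* a pair avoiding A consists of the partners of A outside A, B and Z, and
     B would then have no partner in both this pair and {A, Z} *)
  have sub : P :\: [set A; B; Z] \subset tr x.
    apply/subsetP=> V /setDP[PV nV].
    exact: in_missed_trace PA PV (coA V PV nV) nAx.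
  have eqx : P :\: [set A; B; Z] = tr x.
    apply/eqP; rewrite eqEcard sub (leq_trans lex) //.
    rewrite cardsD (setIidPr _); last first.
      by apply/subsetP=> V; rewrite !inE => /orP[/orP[]|] /eqP->.
    by rewrite ltn_subRL (leq_ltn_trans _ P5) // addn1.
  have [||C [C1 Cx _]] := @partner_in_traces x1 x B PB.
  - by rewrite tr1 !inE negb_or eq_sym AB.
  - by rewrite -eqx !inE eqxx !orbT.
  by move: C1 Cx; rewrite -eqx tr1 !inE => /orP[]/eqP->; rewrite eqxx ?orbT.
have [Y AY trx] := pairE _ _ lex Ax.
apply/subsetP=> V; rewrite trx !inE => /orP[/eqP->|/eqP->]; rewrite ?eqxx //.
apply: contraT; rewrite !negb_or -andbA => /and3P[YA YB YZ].
suff /leq_ltn_trans/(_ P5) : #|P| <= 4 by rewrite ltnn.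
apply: (card_star PA) => U PU UA.
(* three pairs through A: a coalition avoiding A cannot meet B, Z and Y *)
have [C PC UC] := partner PU; have [<-//|CA] := eqVneq C A.
have := tr_cover x0 PU PC UC; have := tr_cover x1 PU PC UC.
have := tr_cover x PU PC UC.
rewrite tr0 tr1 trx !inE (negPf UA) (negPf CA) /=.
by do 3![case/orP=> /eqP ?]; subst; move: BZ YB YZ; rewrite eqxx.
Qed.

Section TwoClassTrace.

Variables (z : T) (A B : K).
Hypotheses (trz : tr z = [set A; B]) (AB : A != B).

Let PA : A \in P. Proof. by apply: (subsetP (trP z)); rewrite trz !inE eqxx. Qed.
Let PB : B \in P.
Proof. by apply: (subsetP (trP z)); rewrite trz !inE eqxx orbT. Qed.

(** All classes but A and B are partners of A or of B, hence lie in a trace that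
    A misses or in a trace that B misses. *)
Lemma two_class_cover x y : A \notin tr x -> B \notin tr y ->
  P \subset [set A; B] :|: (tr x :\ B :|: tr y :\ A).
Proof.
move=> nAx nBy; apply/subsetP=> C PC; rewrite !inE.
have [//|CA] := eqVneq C A; have [//|CB] := eqVneq C B; rewrite /=.
have nCz : C \notin tr z by rewrite trz !inE negb_or CA.
have [D [Dz _ CD]] := partner_in_traces PC nCz nCz.
move: Dz CD; rewrite trz !inE co_sym => /orP[]/eqP-> DC.
  by rewrite (in_missed_trace PA PC DC nAx).
by rewrite (in_missed_trace PB PC DC nBy) orbT.
Qed.

(** With six classes the coalition graph is determined up to the edge AB: the
    partners of A are the two classes of [CS], those of B the two of [DS]. *)
Lemma two_class_trace : 5 < #|P| ->
  #|P| <= 6 /\ exists x y CS DS,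
  [/\ tr x = B |: CS /\ tr y = A |: DS,
      [/\ #|CS| = 2, #|DS| = 2 & [disjoint CS & DS]],
      [/\ A \notin CS, A \notin DS, B \notin CS & B \notin DS],
      forall w, (A \notin tr w -> CS \subset tr w)
             /\ (B \notin tr w -> DS \subset tr w) &
      forall w, #|tr w| <= 2 -> A \in tr w /\ B \in tr w].
Proof.
move=> P6; have [x nAx] := tr_miss PA; have [y nBy] := tr_miss PB.
have sub := two_class_cover nAx nBy.
(* no trace avoids both A and B: otherwise there are at most 2 + 3 classes *)
have miss_one w : A \notin tr w -> B \notin tr w -> False.
  move=> nAw nBw; suff : #|P| <= 5 by rewrite leqNgt P6.
  have /subset_leq_card/leq_trans := two_class_cover nAw nBw; apply.
  apply: (@leq_trans #|[set A; B] :|: tr w|); last first.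
    have := card_tr w; rewrite cardsU cards2 AB.
    by move=> le3; apply: leq_trans (leq_subr _ _) _; rewrite leq_add2l.
  by apply: subset_leq_card; apply: setUS; rewrite subUset !subsetDl.
have Bx : B \in tr x by apply/negPn/negP=> /(miss_one x nAx).
have Ay : A \in tr y by apply/negPn/negP=> nAy; apply: (miss_one y).
set CS := tr x :\ B in sub; set DS := tr y :\ A in sub.
have leC : #|CS| <= 2 by have := card_tr x; rewrite (cardsD1 B) Bx.
have leD : #|DS| <= 2 by have := card_tr y; rewrite (cardsD1 A) Ay.
(* P has at most 2 + 2 + 2 classes, with equality only if CS and DS are
   disjoint pairs *)
have := subset_leq_card sub.
rewrite (cardsU [set A; B]) (cardsU CS) cards2 AB => le.
have tight p c d i j : 5 < p -> c <= 2 -> d <= 2 -> p <= 2 + (c + d - i) - j ->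
  [/\ p <= 6, c = 2, d = 2 & i = 0] by clear; split; lia.
have [leP cardC cardD /cards0_eq CD0] := tight _ _ _ _ _ P6 leC leD le.
have trx : tr x = B |: CS by rewrite setD1K.
have tr_y : tr y = A |: DS by rewrite setD1K.
have dis : [disjoint CS & DS] by rewrite -setI_eq0 CD0.
have nACS : A \notin CS by rewrite !inE negb_and nAx orbT.
have nBDS : B \notin DS by rewrite !inE negb_and nBy orbT.
have coC C : C \in CS -> co A C.
  move=> CC; have := CC; rewrite !inE => /andP[CB Cx].
  have PC : C \in P by apply: (subsetP (trP x)).
  have CA : C != A by apply: contraNneq nAx => <-.
  have nCz : C \notin tr z by rewrite trz !inE negb_or CA.
  have [D [Dz _ CD]] := partner_in_traces PC nCz nCz.
  move: Dz CD; rewrite trz !inE co_sym => /orP[]/eqP-> // BC.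
  have Cy := in_missed_trace PB PC BC nBy.
  by have := disjointFr dis CC; rewrite !inE CA Cy.
have coD D : D \in DS -> co B D.
  move=> DD; have := DD; rewrite !inE => /andP[DA Dy].
  have PD : D \in P by apply: (subsetP (trP y)).
  have DB : D != B by apply: contraNneq nBy => <-.
  have nDz : D \notin tr z by rewrite trz !inE negb_or DA.
  have [C [Cz _ CD]] := partner_in_traces PD nDz nDz.
  move: Cz CD; rewrite trz !inE co_sym => /orP[]/eqP-> // AD.
  have Dx := in_missed_trace PA PD AD nAx.
  by have := disjointFl dis DD; rewrite !inE DB Dx.
have missA w : A \notin tr w -> CS \subset tr w.
  move=> nAw; apply/subsetP=> C CC.
  apply: in_missed_trace PA _ (coC C CC) nAw.
  by apply: (subsetP (trP x)); rewrite trx inE CC orbT.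
have missB w : B \notin tr w -> DS \subset tr w.
  move=> nBw; apply/subsetP=> D DD.
  apply: in_missed_trace PB _ (coD D DD) nBw.
  by apply: (subsetP (trP y)); rewrite tr_y inE DD orbT.
split=> //; exists x, y, CS, DS; split=> //.
- by split; rewrite // !inE eqxx.
- by split; [apply: missA | apply: missB].
move=> w le2; split; apply/negPn/negP=> nw; apply: (miss_one w) => //.
  suff <- : CS = tr w by rewrite !inE eqxx.
  by apply/eqP; rewrite eqEcard missA // cardC.
suff <- : DS = tr w by rewrite !inE eqxx.
by apply/eqP; rewrite eqEcard missB // cardD.
Qed.

End TwoClassTrace.

End Traces.

(** * Closed strong neighbourhoods and strong coalition partitions *)

Section Hoods.

Variables (T : finType) (e : rel T).

(** The vertices that strongly dominate x, including x itself. *)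
Definition hood (x : T) : {set T} :=
  [set y | (y == x) || e x y && (deg e x <= deg e y)].

Lemma strong_dominatingP (D : {set T}) :
  reflect (forall x, exists2 y, y \in hood x & y \in D) (strong_dominating e D).
Proof.
apply: (iffP forall_inP) => [domD x | meetD x xD].
  have [xD|xD] := boolP (x \in D); first by exists x; rewrite // inE eqxx.
  by have /exists_inP[y yD xy] := domD x xD; exists y; rewrite // inE xy orbT.
have [y] := meetD x; rewrite inE => /orP[/eqP-> xD'|xy yD].
  by rewrite xD' in xD.
by apply/exists_inP; exists y.
Qed.

Lemma strong_dominatingPn (D : {set T}) :
  reflect (exists x, forall y, y \in hood x -> y \notin D)
          (~~ strong_dominating e D).
Proof.
apply: (iffP idP) => [|[x missD]]; last first.
  by apply/strong_dominatingP => /(_ x)[y /missD/negPf->].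
rewrite negb_forall_in => /exists_inP[x xD /exists_inPn nex].
exists x => y; rewrite inE => /orP[/eqP->//|xy].
by apply: contraTN xy => /nex.
Qed.

Section Partition.

Variable P : {set {set T}}.
Hypothesis partP : partition P [set: T].

Let trivP : trivIset P. Proof. by case/and3P: partP. Qed.

Lemma mem_cover_partition x : x \in cover P.
Proof. by rewrite (cover_partition partP) inE. Qed.

Lemma pblock_partition x : pblock P x \in P.
Proof. by rewrite pblock_mem ?mem_cover_partition. Qed.

Lemma mem_block A x : A \in P -> (x \in A) = (pblock P x == A).
Proof.
move=> PA; apply/idP/eqP => [xA|<-]; first exact: def_pblock.
by rewrite mem_pblock mem_cover_partition.
Qed.

Lemma block_neq0 A : A \in P -> exists x, pblock P x = A.
Proof.
move=> PA; have /and3P[_ _ P0] := partP.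
have /set0Pn[x xA] : A != set0 by apply: contraNneq P0 => <-.
by exists x; apply/eqP; rewrite -mem_block.
Qed.

(** The blocks of P that meet [hood x]. *)
Definition trace (x : T) : {set {set T}} := [set pblock P y | y in hood x].

Lemma trace_sub x : trace x \subset P.
Proof. by apply/subsetP=> A /imsetP[y _ ->]; apply: pblock_partition. Qed.

Lemma trace_cover A B x : A \in P -> B \in P -> strong_coalition e A B ->
  (A \in trace x) || (B \in trace x).
Proof.
move=> PA PB /and4P[_ _ _ /strong_dominatingP/(_ x)[y xy]].
rewrite inE (mem_block _ PA) (mem_block _ PB).
by case/orP=> /eqP<-; apply/orP; [left|right]; apply: imset_f.
Qed.

Lemma trace_miss A :
  A \in P -> ~~ strong_dominating e A -> exists x, A \notin trace x.
Proof.
move=> PA /strong_dominatingPn[x missA]; exists x.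
apply/imsetP=> -[y /missA yA defA]; move: yA.
by rewrite (mem_block _ PA) -defA eqxx.
Qed.

End Partition.

Lemma strong_coalition_sym : symmetric (strong_coalition e).
Proof.
move=> A B; rewrite /strong_coalition disjoint_sym setUC.
by congr (_ && _); rewrite andbCA.
Qed.

(** A surjective colouring whose colour classes are legal gives a lower bound:
    the classes are pairwise distinct and nonempty. *)
Lemma SC_lower_bound k (c : T -> 'I_k) :
    (forall i, exists x, c x = i) ->
    (forall i, dominating_singleton e (c @^-1: [set i]) \/
       ~~ strong_dominating e (c @^-1: [set i]) /\
       exists j, strong_coalition e (c @^-1: [set i]) (c @^-1: [set j])) ->
  k <= SC e.
Proof.
move=> c_surj coal; pose P := [set c @^-1: [set i] | i : 'I_k].
have inj : injective (fun i => c @^-1: [set i]).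
  move=> i j eqij; have [x cx] := c_surj i.
  by have /setP/(_ x) := eqij; rewrite !inE cx eqxx => /esym/eqP.
have cardP : #|P| = k by rewrite card_imset // card_ord.
apply: leq_trans (_ : #|P| <= _); first by rewrite cardP.
apply: (@leq_bigmax_cond _ _ (fun Q : {set {set T}} => #|Q|)).
apply/andP; split.
  apply/and3P; split.
  - apply/eqP/setP=> x; rewrite inE; apply/bigcupP.
    by exists (c @^-1: [set c x]); rewrite ?inE //; apply: imset_f.
  - apply/trivIsetP=> _ _ /imsetP[i _ ->] /imsetP[j _ ->] neq.
    rewrite -setI_eq0; apply/eqP/setP=> x; rewrite !inE.
    by apply: contraNF neq => /andP[/eqP<- /eqP<-].
  apply/imsetP=> -[i _] /setP; have [x cx] := c_surj i.
  by move/(_ x); rewrite !inE cx eqxx.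
apply/forall_inP=> _ /imsetP[i _ ->]; have [->//|[-> [j ij]]] := coal i.
apply/orP; right; apply/exists_inP; exists (c @^-1: [set j]) => //.
exact: imset_f.
Qed.

Lemma card_partition_le (P : {set {set T}}) :
  partition P [set: T] -> #|P| <= #|T|.
Proof.
move=> partP; rewrite -cardsT (card_partition partP) -sum1_card.
apply: leq_sum => A PA; rewrite card_gt0; apply/eqP=> A0.
by have /and3P[_ _] := partP; rewrite -A0 PA.
Qed.

End Hoods.

(** * Degrees and neighbourhoods in a path *)

Section PathHoods.

Variable n : nat.
Local Notation e := (@path_graph n).

Lemma deg_path (x : 'I_n) : deg e x = (0 < x) + (x.+1 < n).
Proof.
rewrite /deg.
have -> : [set y | e x y] =
    [set y : 'I_n | y.+1 == x] :|: [set y : 'I_n | x.+1 == y].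
  by apply/setP=> y; rewrite !inE orbC.
rewrite cardsU [X in _ - X](_ : _ = 0) ?subn0; last first.
  by apply/eqP; rewrite cards_eq0; apply/eqP/setP=> y; rewrite !inE; lia.
congr (_ + _).
  have [x0|x0] := posnP x.
    by apply/eqP; rewrite cards_eq0; apply/eqP/setP=> y; rewrite !inE x0.
  have lt : x.-1 < n by have := ltn_ord x; lia.
  rewrite -[RHS](cards1 (Ordinal lt)); apply/eq_card=> y.
  by rewrite !inE -val_eqE /=; lia.
have [lt|ge] := ltnP x.+1 n.
  rewrite -[RHS](cards1 (Ordinal lt)); apply/eq_card=> y.
  by rewrite !inE -val_eqE /= eq_sym.
apply/eqP; rewrite cards_eq0; apply/eqP/setP=> y; rewrite !inE.
by have := ltn_ord y; lia.
Qed.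

(** For n > 2 an interior vertex strongly dominates its neighbours, and an end
    vertex only itself. *)
Lemma mem_hood_path (x y : 'I_n) : 2 < n ->
  (y \in hood e x) = (y == x) || e x y && (0 < y < n.-1).
Proof.
move=> n3; rewrite inE !deg_path -val_eqE /= /path_graph.
by have := ltn_ord x; have := ltn_ord y; lia.
Qed.

End PathHoods.

(** * The length of a word with six classes *)

Lemma card2_sub3 (K : finType) (S : {set K}) (a b c : K) :
  #|S| = 2 -> S \subset [set a; b; c] -> (a \in S) || (b \in S).
Proof.
move=> S2 /subsetP sub; apply: contraT; rewrite negb_or => /andP[aS bS].
have /subset_leq_card : S \subset [set c]; last by rewrite S2 cards1.
apply/subsetP=> d dS; have := sub d dS; rewrite !inE.
by case/orP=> [/orP[]|//] /eqP eqd; rewrite eqd (negPf aS, negPf bS) in dS.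
Qed.

Lemma card3_neq (K : finType) (a b c : K) :
  #|[set a; b; c]| = 3 -> [/\ a != b, a != c & b != c].
Proof.
by rewrite setUC cardsU1 cards2 !inE negb_or ![c == _]eq_sym; do 3!case: (_ == _).
Qed.

(** A word [v 0, ..., v (n-1)] of classes along a path, with A and B its first
    two letters; [window i] is the trace of an interior position i. The
    hypotheses are the properties of the traces given by six classes. *)
Section Words.

Variables (K : finType) (v : nat -> K) (n : nat) (CS DS : {set K}).
Local Notation A := (v 0).
Local Notation B := (v 1).
Local Notation window i := [set v i.-1; v i; v i.+1].

Hypothesis n4 : 3 < n.
Hypothesis AB : A != B.
Hypotheses (cardC : #|CS| = 2) (cardD : #|DS| = 2).
Hypothesis CD : [disjoint CS & DS].
Hypotheses (AC : A \notin CS) (AD : A \notin DS).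
Hypotheses (BC : B \notin CS) (BD : B \notin DS).
Hypothesis second : A \in [set B; v 2].
Hypothesis penult :
  A \in [set v (n - 3); v (n - 2)] /\ B \in [set v (n - 3); v (n - 2)].
Hypothesis missA : forall i,
  1 < i < n - 2 -> A \notin window i -> CS \subset window i.
Hypothesis missB : forall i,
  1 < i < n - 2 -> B \notin window i -> DS \subset window i.

Variables x y : nat.
Hypotheses (x_mid : 1 < x < n - 2) (y_mid : 1 < y < n - 2).
Hypotheses (windowx : window x = B |: CS) (windowy : window y = A |: DS).

(** The window at x avoids A, so it lies strictly between the initial A B A and
    the last A; the window at y avoids B; and the two windows are disjoint.
    This leaves a few positions for n <= 11, each excluded by a window that
    contains two letters of [CS] or of [DS]. *)
Lemma word_length : 12 <= n.
Proof.
have window_mem i j : i <= j.+1 -> j <= i.+1 -> v j \in window i.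
  move=> ij ji; have [->|[->|->]] : j = i.-1 \/ j = i \/ j = i.+1.
    by move: ij ji; clear; lia.
  - by rewrite !inE eqxx.
  - by rewrite !inE eqxx orbT.
  by rewrite !inE eqxx !orbT.
have inX j : x <= j.+1 -> j <= x.+1 -> v j \in B |: CS.
  by move=> xj jx; rewrite -windowx window_mem.
have inY j : y <= j.+1 -> j <= y.+1 -> v j \in A |: DS.
  by move=> yj jy; rewrite -windowy window_mem.
have XY k : k \in B |: CS -> k \in A |: DS -> False.
  rewrite !inE => /orP[/eqP->|kC] /orP[kA|kD]; move: AB BD.
  - by rewrite eq_sym kA.
  - by rewrite kD.
  - by move: kC; rewrite (eqP kA) (negPf AC).
  by rewrite (disjointFr CD kC) in kD.
have AX : A \notin B |: CS by apply/negP=> /XY; apply; rewrite !inE eqxx.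
have BY : B \notin A |: DS by apply/negP; apply: XY; rewrite !inE eqxx.
have XC k : k \in A |: DS -> k \notin CS.
  by move=> kY; apply/negP=> kC; apply: (XY k) => //; rewrite inE kC orbT.
have YD k : k \in B |: CS -> k \notin DS.
  by move=> kX; apply/negP=> kD; apply: (XY k) => //; rewrite inE kD orbT.
have v2 : v 2 = A by move: second; rewrite !inE (negPf AB) => /eqP.
have [neqx1 neqx2 neqx3] : [/\ v x.-1 != v x, v x.-1 != v x.+1 & v x != v x.+1].
  by apply: card3_neq; rewrite windowx cardsU1 BC cardC.
have [neqy1 neqy2 neqy3] : [/\ v y.-1 != v y, v y.-1 != v y.+1 & v y != v y.+1].
  by apply: card3_neq; rewrite windowy cardsU1 AD cardD.
have x_ge : 4 <= x.
  rewrite leqNgt; apply/negP=> lt4; case/negP: AX; rewrite -[A]v2.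
  by apply: inX; move: x_mid lt4; clear; lia.
have x_le : x + 4 <= n.
  rewrite leqNgt; apply/negP=> gt; case/negP: AX.
  by case: penult => /set2P[]-> _; apply: inX; move: x_mid gt; clear; lia.
have y_ge : 3 <= y.
  by rewrite leqNgt; apply/negP=> lt3; case/negP: BY; apply: inY;
    move: y_mid lt3; clear; lia.
have y_le : y + 4 <= n.
  rewrite leqNgt; apply/negP=> gt; case/negP: BY.
  by case: penult => _ /set2P[]->; apply: inY; move: y_mid gt; clear; lia.
have far : (x + 3 <= y) || (y + 3 <= x).
  apply/negPn/negP=> near.
  have [j [xj jx yj jy]] : exists j,
      [/\ x <= j.+1, j <= x.+1, y <= j.+1 & j <= y.+1].
    by exists (maxn x y).-1; move: near x_ge; clear => near x_ge; split; lia.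
  by apply: (XY (v j)); [apply: inX | apply: inY].
rewrite leqNgt; apply/negP=> n11.
case/orP: far => [xy|yx].
  (* the windows occupy positions 3-5 and 6-8; then window 6 would need A or CS *)
  have [y7 [n11' x4]] : y = 7 /\ n = 11 /\ x = 4.
    by move: n11 xy x_ge y_le; clear; lia.
  subst y n x; have v8 : v 8 = A.
    have v8B : B != v 8 by apply: contraNneq BY => ->; apply: inY.
    case: penult => /set2P[//|eA] /set2P[eB|eB]; first by case/eqP: v8B.
    by case/eqP: AB; rewrite eA eB.
  have v5A : A != v 5 by apply: contraNneq AX => ->; apply: inX.
  rewrite v8 in neqy2 neqy3.
  have nA : A \notin window 6.
    by rewrite !inE ![A == _]eq_sym negb_or negb_or eq_sym v5A neqy2.
  have sub := @missA 6 isT nA; rewrite -setUA setUC in sub.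
  by case/orP: (card2_sub3 cardC sub); apply/negP; apply: XC; apply: inY.
(* after A followed by two letters of DS, window 4 still needs an A *)
have v5 : y = 3 -> v 5 = A.
  move=> y3; subst y.
  have mid4 : 1 < 4 < n - 2 by move: x_ge x_le; clear; lia.
  have [Y3 Y4] : v 3 \in A |: DS /\ v 4 \in A |: DS by split; apply: inY.
  have : A \in window 4.
    apply/negPn/negP=> nA; have sub := @missA 4 mid4 nA.
    by case/orP: (card2_sub3 cardC sub); apply/negP; apply: XC.
  move: neqy1 neqy2; rewrite /= v2 !inE => /negPf-> /negPf->.
  by move/eqP.
(* the window at x must occupy 6-8, but then window 6 would need B or DS *)
have [x7 n11'] : x = 7 /\ n = 11.
  suff : ~ (x = 6 /\ y = 3) by move: n11 yx x_le y_ge; clear; lia.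
  by move=> [x6 y3]; case/negP: AX; rewrite -[A](v5 y3); apply: inX; rewrite x6.
subst x n; have v8 : v 8 = B.
  have v8A : A != v 8 by apply: contraNneq AX => ->; apply: inX.
  case: penult => /set2P[eA|eA] /set2P[//|eB]; first by case/eqP: v8A.
  by case/eqP: AB; rewrite eA eB.
have v5B : B != v 5.
  have [y3|y4] : y = 3 \/ y = 4 by move: y_ge yx; clear; lia.
    by rewrite v5 // eq_sym.
  by apply: contraNneq BY => ->; apply: inY; rewrite y4.
rewrite v8 in neqx2 neqx3.
have nB : B \notin window 6.
  by rewrite !inE ![B == _]eq_sym negb_or negb_or eq_sym v5B neqx2.
have sub := @missB 6 isT nB; rewrite -setUA setUC in sub.
by case/orP: (card2_sub3 cardD sub); apply/negP; apply: YD; apply: inX.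
Qed.

End Words.

(** * Upper bounds for paths *)

(** The positions of [hood x] in the path on n > 2 vertices, as natural numbers;
    0 may occur twice when x = 0, since [0.-1] is 0. *)
Definition path_hood (n x : nat) : seq nat :=
  [seq y <- [:: x.-1; x; x.+1] | (y == x) || (0 < y < n.-1)].

Lemma path_hoodP n (x : 'I_n) (p : pred nat) : 2 < n ->
  (exists2 y : 'I_n, y \in hood (@path_graph n) x & p y) <->
  has p (path_hood n x).
Proof.
move=> n3; split=> [[y xy py]|/hasP[y]].
  apply/hasP; exists (val y) => //.
  move: xy; rewrite mem_hood_path // mem_filter !inE -val_eqE /= /path_graph.
  by clear; lia.
rewrite mem_filter !inE => xy py.
have ltyn : y < n by move: xy (ltn_ord x); clear; lia.
exists (Ordinal ltyn) => //.
rewrite mem_hood_path // -val_eqE /= /path_graph /=.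
by move: xy; clear; lia.
Qed.

Section PathUpperBounds.

Variables (m : nat) (P : {set {set 'I_m.+1}}).
Local Notation n := m.+1.
Local Notation e := (@path_graph n).

Hypothesis n4 : 3 < n.
Hypothesis scP : strong_coalition_partition e P.

Let partP : partition P [set: 'I_n]. Proof. by case/andP: scP. Qed.

Local Notation tr := (trace e P).
(* the class of position i *)
Let v (i : nat) : {set 'I_n} := pblock P (inord i).

Lemma path_no_dominating_singleton A : ~~ dominating_singleton e A.
Proof.
apply/negP=> /andP[_ /existsP[x /andP[_]]]; rewrite deg_path card_ord.
by have := ltn_ord x; move: n4; clear; lia.
Qed.

Lemma path_partner A : A \in P ->
  ~~ strong_dominating e A /\ exists2 B, B \in P & strong_coalition e A B.
Proof.
move=> PA; have /andP[_ /forall_inP/(_ A PA)] := scP.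
rewrite (negPf (path_no_dominating_singleton A)) /= => /andP[-> /exists_inP[B]].
by split=> //; exists B.
Qed.

Lemma path_traceE (x : 'I_n) : tr x = [set A in [seq v y | y <- path_hood n x]].
Proof.
apply/setP=> A; rewrite inE; apply/imsetP/mapP => [[y xy ->]|[y yx ->]].
  have /path_hoodP : exists2 z : 'I_n, z \in hood e x & pred1 (val y) z.
    by exists y => //=.
  move/(_ (ltnW n4))/hasP=> [z zx /eqP zy]; exists z => //.
  by rewrite /v zy inord_val.
have /(path_hoodP _ _ (ltnW n4))[z xz /eqP zy] : has (pred1 y) (path_hood n x).
  by apply/hasP; exists y => //=.
by exists z => //; rewrite /v -zy inord_val.
Qed.

Lemma card_path_trace x : #|tr x| <= 3.
Proof.
rewrite path_traceE cardsE (leq_trans (card_size _)) // size_map.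
by rewrite size_filter (leq_trans (count_size _ _)).
Qed.

Lemma path_trace_first : tr (inord 0) = [set v 0; v 1].
Proof.
rewrite path_traceE inordK // /path_hood /=.
have -> : 1 < m by move: n4; clear; lia.
by apply/setP=> A; rewrite !inE orbA orbb.
Qed.

Lemma path_trace_second : tr (inord 1) = [set v 1; v 2].
Proof.
rewrite path_traceE inordK ?(ltnW (ltnW n4)) // /path_hood /=.
have -> : 2 < m by move: n4; clear; lia.
by apply/setP=> A; rewrite !inE.
Qed.

Lemma path_trace_mid i : 1 < i < n - 2 ->
  tr (inord i) = [set v i.-1; v i; v i.+1].
Proof.
move=> imid; rewrite path_traceE inordK; last by move: imid; clear; lia.
rewrite /path_hood /=; have -> : 0 < i.-1 < m by move: imid; clear; lia.
have -> : i.+1 < m by move: imid; clear; lia.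
by apply/setP=> A; rewrite eqxx orbT !inE orbT /= !inE orbA.
Qed.

Lemma path_trace_penult : tr (inord (n - 2)) = [set v (n - 3); v (n - 2)].
Proof.
rewrite path_traceE inordK; last by move: n4; clear; lia.
have -> : path_hood n (n - 2) = [:: n - 3; n - 2].
  rewrite /path_hood /= eqxx.
  have -> : (n - 2).-1 = n - 3 by clear; lia.
  have -> : 0 < n - 3 < m by move: n4; clear; lia.
  have -> : (((n - 2).+1 == n - 2) || ((n - 2).+1 < m)) = false.
    by move: n4; clear; lia.
  by rewrite orbT.
by apply/setP=> A; rewrite !inE.
Qed.

Lemma path_trace_last : tr (inord (n - 1)) = [set v (n - 2); v (n - 1)].
Proof.
rewrite path_traceE inordK; last by clear; lia.
have -> : path_hood n (n - 1) = [:: n - 2; n - 1].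
  rewrite /path_hood /= eqxx.
  have -> : (n - 1).-1 = n - 2 by clear; lia.
  have -> : 0 < n - 2 < m by move: n4; clear; lia.
  have -> : (((n - 1).+1 == n - 1) || ((n - 1).+1 < m)) = false.
    by move: n4; clear; lia.
  by rewrite orbT.
by apply/setP=> A; rewrite !inE.
Qed.

Lemma path_trace_mid_card (x : 'I_n) : 2 < #|tr x| -> 1 < x < n - 2.
Proof.
move=> big; apply/negPn/negP=> nmid.
have : [\/ x = inord 0, x = inord 1, x = inord (n - 2) | x = inord (n - 1)].
  have [x0|[x1|[x2|x3]]] :
      val x = 0 \/ val x = 1 \/ val x = n - 2 \/ val x = n - 1.
    by move: nmid (ltn_ord x) n4; rewrite /=; clear; lia.
  - by apply: Or41; rewrite -x0 inord_val.
  - by apply: Or42; rewrite -x1 inord_val.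
  - by apply: Or43; rewrite -x2 inord_val.
  - by apply: Or44; rewrite -x3 inord_val.
by case=> eqx; move: big; rewrite eqx (path_trace_first, path_trace_second,
  path_trace_penult, path_trace_last) cards2 ltnS ltnNge leq_b1.
Qed.

(** For n <= 7 every position but 3 belongs to the neighbourhood of one of the
    vertices 0, 1, n-2, n-1, whose traces have at most two classes. *)
Lemma card_path_partition_small : n <= 7 -> #|P| <= 4.
Proof.
move=> n7; rewrite leqNgt; apply/negP=> P5.
set U := \bigcup_(x | #|tr x| <= 2) tr x.
have leU : #|U| <= 3.
  apply: (@card_pair_traces _ _ P (strong_coalition e)) => //.
  - exact: strong_coalition_sym.
  - by move=> x; apply: trace_sub.
  - by move=> A /path_partner[].
  - by move=> A B x PA PB; apply: trace_cover.
  - by move=> A PA; have [nA _] := path_partner PA; apply: trace_miss.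
  - exact: card_path_trace.
have inU i A : #|tr (inord i)| <= 2 -> A \in tr (inord i) -> A \in U.
  by move=> le2 Ai; apply/bigcupP; exists (inord i).
have le2 (A B : {set 'I_n}) : #|[set A; B]| <= 2 by rewrite cards2 ltnS leq_b1.
have sub : P \subset v 3 |: U.
  apply/subsetP=> A PA; have [x <-] := block_neq0 partP PA.
  have -> : pblock P x = v x by rewrite /v inord_val.
  have [->|[->|[->|[->|[->|[->| ->]]]]]] : x = 0 :> nat \/ x = 1 :> nat \/
      x = 2 :> nat \/ x = 3 :> nat \/ x = n - 3 :> nat \/ x = n - 2 :> nat \/
      x = n - 1 :> nat.
    by move: (ltn_ord x) n7 n4; clear; lia.
  - by rewrite inE (inU 0) ?orbT // path_trace_first // !inE eqxx.
  - by rewrite inE (inU 1) ?orbT // path_trace_second // !inE eqxx.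
  - by rewrite inE (inU 1) ?orbT // path_trace_second // !inE eqxx orbT.
  - by rewrite !inE eqxx.
  - by rewrite inE (inU (n - 2)) ?orbT // path_trace_penult // !inE eqxx.
  - by rewrite inE (inU (n - 2)) ?orbT // path_trace_penult // !inE eqxx orbT.
  - by rewrite inE (inU (n - 1)) ?orbT // path_trace_last // !inE eqxx orbT.
have := subset_leq_card sub; rewrite cardsU1 leqNgt => /negP; apply.
by apply: leq_trans P5; rewrite ltnS (leq_add (leq_b1 _) leU).
Qed.

Lemma card_path_partition : 5 < #|P| -> #|P| <= 6 /\ 12 <= n.
Proof.
move=> P6.
have trP x : tr x \subset P by apply: trace_sub.
have partner A : A \in P -> exists2 B, B \in P & strong_coalition e A B.
  by move/path_partner=> [].
have cover A B x : A \in P -> B \in P -> strong_coalition e A B ->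
    (A \in tr x) || (B \in tr x).
  by move=> PA PB; apply: trace_cover.
have miss A : A \in P -> exists x, A \notin tr x.
  by move=> PA; have [nA _] := path_partner PA; apply: trace_miss.
have AB : v 0 != v 1.
  have := card_trace_gt1 (@strong_coalition_sym _ e) trP partner cover miss
    card_path_trace (inord 0) (ltnW P6).
  by rewrite path_trace_first cards2; case: (_ != _).
have [le6 [x [y [CS [DS [[trx try_] [cardC cardD CD]
    [AC AD BC BD] inout pair]]]]]] :=
  two_class_trace (@strong_coalition_sym _ e) trP partner cover miss
    card_path_trace path_trace_first AB P6.
have le2 (A B : {set 'I_n}) : #|[set A; B]| <= 2 by rewrite cards2 ltnS leq_b1.
split=> //.
have xmid : 1 < x < n - 2.
  by apply: path_trace_mid_card; rewrite trx cardsU1 BC cardC.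
have ymid : 1 < y < n - 2.
  by apply: path_trace_mid_card; rewrite try_ cardsU1 AD cardD.
have windowE i : 1 < i < n - 2 -> [set v i.-1; v i; v i.+1] = tr (inord i).
  by move=> imid; rewrite path_trace_mid.
apply: (@word_length _ v n CS DS n4 AB cardC cardD CD AC AD BC BD
          _ _ _ _ x y) => //.
- by rewrite -path_trace_second; apply pair; rewrite path_trace_second.
- by rewrite -path_trace_penult; apply pair; rewrite path_trace_penult.
- by move=> i imid; rewrite windowE //; apply inout.
- by move=> i imid; rewrite windowE //; apply inout.
- by rewrite windowE // inord_val.
- by rewrite windowE // inord_val.
Qed.

End PathUpperBounds.

(** * Lower bounds for paths from explicit words *)

Section PathLowerBound.

Variables (n k : nat) (w : nat -> nat).

(** A word over k letters, read as a colouring of the path, witnesses k if every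
    letter occurs, misses some neighbourhood, and has a distinct partner letter
    such that the two together meet all neighbourhoods. *)
Lemma path_word_lower_bound : 2 < n ->
    (forall x, x < n -> w x < k) ->
    (forall i, i < k -> exists2 x, x < n & w x = i) ->
    (forall i, i < k -> exists2 x, x < n &
       all (fun y => w y != i) (path_hood n x)) ->
    (forall i, i < k -> exists j, [/\ j < k, j != i & forall x, x < n ->
       has (fun y => (w y == i) || (w y == j)) (path_hood n x)]) ->
  k <= SC (@path_graph n).
Proof.
move=> n3 w_lt w_surj w_miss w_part.
pose c (x : 'I_n) := Ordinal (w_lt x (ltn_ord x)).
have ndom (i : 'I_k) : ~~ strong_dominating (@path_graph n) (c @^-1: [set i]).
  have [x xn /allP miss] := w_miss i (ltn_ord i).
  apply/strong_dominatingP=> /(_ (Ordinal xn))[y xy]; rewrite !inE -val_eqE /=.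
  apply/negP; have /hasP[z zx /eqP<-] : has (pred1 (val y)) (path_hood n x).
    by apply/(path_hoodP (Ordinal xn)) => //; exists y => //=.
  exact: miss.
apply: (@SC_lower_bound _ _ k c) => i.
  have [x xn wx] := w_surj i (ltn_ord i).
  by exists (Ordinal xn); apply: val_inj.
right; split=> //; have [j [jk ji dom]] := w_part i (ltn_ord i).
exists (Ordinal jk); rewrite /strong_coalition !ndom /=; apply/andP; split.
  rewrite -setI_eq0; apply/eqP/setP=> x; rewrite !inE -!val_eqE /=.
  by apply: contraNF ji => /andP[/eqP<- /eqP<-].
apply/strong_dominatingP=> x.
have /(path_hoodP _ _ n3)[y xy wy] := dom x (ltn_ord x).
by exists y; rewrite // !inE -!val_eqE.
Qed.

End PathLowerBound.

(** The hypotheses of [path_word_lower_bound] as a computable test. *)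
Definition word_check (n k : nat) (w : nat -> nat) : bool :=
  [&& 2 < n,
      all (fun x => w x < k) (iota 0 n),
      all (fun i => has (fun x => w x == i) (iota 0 n)) (iota 0 k),
      all (fun i => has (fun x => all (fun y => w y != i) (path_hood n x))
                        (iota 0 n)) (iota 0 k) &
      all (fun i => has (fun j => (j != i) &&
             all (fun x => has (fun y => (w y == i) || (w y == j))
                               (path_hood n x)) (iota 0 n)) (iota 0 k))
          (iota 0 k)].

Lemma word_check_SC n k w : word_check n k w -> k <= SC (@path_graph n).
Proof.
have mem i m : i < m -> i \in iota 0 m by rewrite mem_iota.
case/and5P=> n3 /allP lt /allP surj /allP miss /allP part.
apply: (path_word_lower_bound (w := w)) => // [x /mem/lt //|i|i|i] /mem ik.
- have /hasP[x] := surj i ik; rewrite mem_iota => xn /eqP.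
  by exists x.
- have /hasP[x] := miss i ik; rewrite mem_iota => xn.
  by exists x.
have /hasP[j] := part i ik; rewrite mem_iota => jk /andP[ji /allP dom].
by exists j; split=> // x /mem/dom.
Qed.

(** Words for four, five and six classes; each ends with an alternation of the
    letters 0 and 1. *)
Definition word4 (x : nat) : nat := if x < 4 then x else odd x.
Definition word5 (x : nat) : nat := if x < 5 then x else ~~ odd x.
Definition word6 (x : nat) : nat :=
  if x < 9 then nth 0 [:: 0; 1; 0; 4; 5; 0; 1; 2; 3] x else odd x.

Lemma SC_path_ge4 n : 4 <= n <= 7 -> 4 <= SC (@path_graph n).
Proof.
move=> n47; apply: (@word_check_SC _ _ word4).
by have : n \in iota 4 4; [rewrite mem_iota | move: n {n47}; apply/allP].
Qed.

Lemma SC_path_ge5 n : 8 <= n <= 11 -> 5 <= SC (@path_graph n).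
Proof.
move=> n811; apply: (@word_check_SC _ _ word5).
by have : n \in iota 8 4; [rewrite mem_iota | move: n {n811}; apply/allP].
Qed.

(** Positions x < 10 have the same neighbourhood as for n = 12, where the
    conditions are checked by computation. For x >= 10 the neighbourhood contains
    x-1 and x, which carry both letters 0 and 1, and every coalition used below
    contains the class 0 or the class 1. *)
Lemma SC_path_ge6 n : 12 <= n -> 6 <= SC (@path_graph n).
Proof.
move=> n12.
have mem i m : i < m -> i \in iota 0 m by rewrite mem_iota.
have hood12 x : x < 10 -> path_hood n x = path_hood 12 x.
  move=> x10; rewrite /path_hood; apply: eq_in_filter => y.
  by rewrite !inE; move: x10 n12; clear; lia.
have tail x : 9 <= x -> word6 x = odd x.
  by move=> x9; rewrite /word6 ltnNge x9.
apply: (path_word_lower_bound (w := word6)).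
- by move: n12; clear; lia.
- move=> x _; have [/mem|x9] := ltnP x 9; first by move: x; apply/allP.
  by rewrite tail //; case: odd.
- move=> i /mem.
  have : all (fun i => has (fun x => word6 x == i) (iota 0 10)) (iota 0 6) by [].
  move/allP=> surj /surj/hasP[x]; rewrite mem_iota => x10 /eqP.
  by exists x; first by move: x10 n12; clear; lia.
- move=> i /mem; have : all (fun i => has (fun x =>
    all (fun y => word6 y != i) (path_hood 12 x)) (iota 0 10)) (iota 0 6) by [].
  move/allP=> miss /miss/hasP[x]; rewrite mem_iota => x10.
  by exists x; [move: x10 n12; clear; lia | rewrite hood12].
move=> i /mem; have : all (fun i => has (fun j => [&& j != i, (i < 2) || (j < 2) &
    all (fun x => has (fun y => (word6 y == i) || (word6 y == j))
                      (path_hood 12 x)) (iota 0 10)]) (iota 0 6)) (iota 0 6) by [].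
move/allP=> part /part/hasP[j]; rewrite mem_iota => j6 /and3P[ji ij2 /allP dom].
exists j; split=> // x xn; have [x10|x10] := ltnP x 10.
  by rewrite hood12 //; apply/dom/mem.
have [y [y9 xy yij]] : exists y, [/\ 9 <= y, y \in path_hood n x &
    (odd y == i :> nat) || (odd y == j :> nat)].
  have in1 : x \in path_hood n x by rewrite mem_filter !inE eqxx orbT.
  have in2 : x.-1 \in path_hood n x.
    by rewrite mem_filter !inE eqxx; move: x10 xn; clear; lia.
  have [|neq] := boolP ((odd x == i :> nat) || (odd x == j :> nat)).
    by exists x; split=> //; move: x10; clear; lia.
  exists x.-1; split=> //; first by move: x10; clear; lia.
  by move: ij2 x10 neq; clear; lia.
by apply/hasP; exists y => //; rewrite tail.
Qed.

Lemma SC_path_small n : 0 < n <= 2 -> SC (@path_graph n) = n.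
Proof.
move=> n12; apply/eqP; rewrite eqn_leq; apply/andP; split.
  apply/bigmax_leqP=> P /andP[partP _].
  by rewrite -[X in _ <= X]card_ord; apply: card_partition_le.
apply: (@SC_lower_bound _ _ n id) => i; first by exists i.
left; apply/andP; split.
  apply/strong_dominatingP=> x; exists i; rewrite !inE // !deg_path -val_eqE /=.
  rewrite /path_graph; move: (ltn_ord i) (ltn_ord x) n12; clear; lia.
apply/existsP; exists i; rewrite deg_path card_ord; apply/andP; split.
  by apply/eqP/setP=> x; rewrite !inE.
move: (ltn_ord i) n12; clear; lia.
Qed.

(** In the path on three vertices a set is strong dominating iff it contains the
    middle vertex. The class of the middle vertex must then be a singleton, and
    the class of an end vertex has no partner, since that partner would itself
    be strong dominating. *)
Lemma SC_path3 : SC (@path_graph 3) = 0.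
Proof.
apply: big_pred0 => P; apply/negP=> /andP[partP /forall_inP scP].
pose o : 'I_3 := inord 1.
have oE : o = 1 :> nat by rewrite inordK.
have domE D : strong_dominating (@path_graph 3) D = (o \in D).
  apply/strong_dominatingP/idP => [/(_ o)[y]|oD x].
    rewrite mem_hood_path // -val_eqE /path_graph /= oE => hy yD.
    suff -> : o = y by [].
    by apply: val_inj; rewrite /= oE; move: hy; clear; lia.
  exists o => //; rewrite mem_hood_path // -val_eqE /path_graph /= oE.
  by have := ltn_ord x; lia.
have [PK PL] := (pblock_partition partP o, pblock_partition partP ord0).
have oK : o \in pblock P o by rewrite (mem_block partP).
have := scP _ PK; rewrite domE oK orbF => /andP[_ /existsP[x /andP[/eqP defK _]]].
have oL : o \notin pblock P ord0.
  rewrite (mem_block partP) //; apply/eqP=> KL.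
  have : ord0 \in pblock P o by rewrite KL (mem_block partP).
  move: oK; rewrite defK !inE => /eqP<- /eqP /(congr1 val) /=.
  by rewrite oE.
have := scP _ PL; rewrite /dominating_singleton domE (negPf oL) /=.
case/exists_inP=> B _ /and4P[_ _]; rewrite !domE inE (negPf oL) /=.
by move/negPf->.
Qed.

(** * The strong coalition number of a path *)

Theorem theorem5p7 (n : nat) (hn : 1 <= n) :
  SC (@path_graph n) =
    if n == 1 then 1
    else if n == 2 then 2
    else if n == 3 then 0
    else if n <= 7 then 4
    else if n <= 11 then 5
    else 6.
Proof.
have [->|n1] := eqVneq n 1; first exact: SC_path_small.
have [->|n2] := eqVneq n 2; first exact: SC_path_small.
have [->|n3] := eqVneq n 3; first exact: SC_path3.
have n4 : 3 < n by move: hn n1 n2 n3; clear; lia.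
case: n n4 {hn n1 n2 n3} => // m n4.
apply/eqP; rewrite eqn_leq; apply/andP; split; last first.
  have [n7|n7] := leqP m.+1 7; first by rewrite SC_path_ge4 ?n4.
  have [n11|n11] := leqP m.+1 11; first by rewrite SC_path_ge5 ?n7.
  exact: SC_path_ge6.
apply/bigmax_leqP=> P scP.
have [n7|n7] := leqP m.+1 7; first exact: card_path_partition_small scP n7.
have big := card_path_partition n4 scP.
have [n11|n11] := leqP m.+1 11; rewrite leqNgt; apply/negP=> P6.
  by have [_] := big P6; rewrite leqNgt ltnS n11.
by have [] := big (ltnW P6); rewrite leqNgt P6.
Qed.
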